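(* Let $E$ be a finite set and $\mathcal{P} \subseteq 2^E$. Then the following two statements are equivalent: (1) $(E, \mathcal{P})$ has the weak max-flow/min-cut property. (2) For every $\mu \in [0,1]^E$, the triple $(E, \mathcal{P}, \pi)$ with $\pi_P := 1 - \sum_{e \in P} \mu_e$ for all $P \in \mathcal{P}$ is $(\star)$-sufficient.
   Context: For a finite set $E$, a family $\mathcal{P} \subseteq 2^E$, marginals $\rho \in [0,1]^E$ and requirements $\pi \in [0,1]^{\mathcal{P}}$, a feasible decomposition of $\rho$ for $(E,\mathcal{P},\pi)$ is a vector $x \in \mathbb{R}^{2^E}$ with $x_S \ge 0$ for all $S \subseteq E$, $\sum_{S \subseteq E} x_S = 1$, $\sum_{S \subseteq E: e \in S} x_S = \rho_e$ for all $e \in E$, and $\sum_{S \subseteq E : S \cap P \neq \emptyset} x_S \ge \pi_P$ for all $P \in \mathcal{P}$ (i.e., a probability distribution of a random set $S$ with $\Pr[e\in S]=\rho_e$ and $\Pr[S\cap P\neq\emptyset]\ge \pi_P$). $\rho$ is called feasible if such a decomposition exists. Condition $(\star)$ for $\rho$ is: $\sum_{e \in P} \rho_e \ge \pi_P$ for all $P \in \mathcal{P}$. The triple $(E,\mathcal{P},\pi)$ is $(\star)$-sufficient if for every $\rho \in [0,1]^E$, $\rho$ is feasible if and only if $\rho$ satisfies $(\star)$. The set system $(E,\mathcal{P})$ has the weak max-flow/min-cut property if the polyhedron $Y_{\mathcal{P}} := \{y \in \mathbb{R}_+^E : \sum_{e \in P} y_e \ge 1 \ \forall P \in \mathcal{P}\}$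 is integral. *)

(* Defs.v *)
From HB Require Import structures.
From mathcomp Require Import all_boot all_order all_algebra.
From mathcomp Require Import classical_sets reals.

Set Implicit Arguments.
Unset Strict Implicit.
Unset Printing Implicit Defensive.

Import Order.TTheory GRing.Theory Num.Theory.
Local Open Scope ring_scope.

Section Decompositions.
Variables (R : realType) (E : finType).
Implicit Types (PP : {set {set E}}) (rho mu : {ffun E -> R}).

Definition in_unit_cube (v : {ffun E -> R}) : Prop :=
  forall e, 0 <= v e <= 1.

(* Requirements are real numbers indexed by all subsets of [E]; only the values
   on members of [PP] matter. They are not confined to [0, 1], because
   [1 - \sum_(e in P) mu e] may be negative; a negative requirement imposes
   nothing, neither below nor in [star]. *)
Definition feasible_decomposition PP (pi : {set E} -> R) rho
    (x : {ffun {set E} -> R}) : Prop :=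
  [/\ forall S, 0 <= x S,
      \sum_(S : {set E}) x S = 1,
      forall e, \sum_(S : {set E} | e \in S) x S = rho e
    & forall P, P \in PP ->
        pi P <= \sum_(S : {set E} | S :&: P != finset.set0) x S].

Definition feasible PP (pi : {set E} -> R) rho : Prop :=
  exists x, feasible_decomposition PP pi rho x.

Definition star PP (pi : {set E} -> R) rho : Prop :=
  forall P, P \in PP -> pi P <= \sum_(e in P) rho e.

Definition star_sufficient PP (pi : {set E} -> R) : Prop :=
  forall rho, in_unit_cube rho -> (feasible PP pi rho <-> star PP pi rho).

Definition convex_hull (A : set {ffun E -> R}) : set {ffun E -> R} :=
  [set y : {ffun E -> R} | exists (n : nat) (w : 'I_n -> R) (v : 'I_n -> {ffun E -> R}),
     [/\ forall i, 0 <= w i,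
         \sum_i w i = 1,
         forall i, A (v i)
       & forall e, y e = \sum_i w i * v i e]]%classic.

Definition integral_points (A : set {ffun E -> R}) : set {ffun E -> R} :=
  [set y : {ffun E -> R} | A y /\ forall e, y e \is a Num.int]%classic.

(* A polyhedron is integral when it is the convex hull of its integral points;
   in particular the empty polyhedron is integral. *)
Definition integral_polyhedron (Y : set {ffun E -> R}) : Prop :=
  Y = convex_hull (integral_points Y).

Definition covering_polyhedron PP : set {ffun E -> R} :=
  [set y : {ffun E -> R} | (forall e, 0 <= y e) /\
     (forall P, P \in PP -> 1 <= \sum_(e in P) y e)]%classic.

Definition weak_mfmc PP : Prop :=
  integral_polyhedron (covering_polyhedron PP).

End Decompositions.

Arguments weak_mfmc R {E} PP.

(* Main.v *)
(** Write [1_S] for the indicator vector of [S].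

    (1) => (2): if [rho] satisfies the star condition then [y := rho + mu] lies
    in the covering polyhedron, hence [y] is a convex combination of integral
    points, whose supports form a random set [T] hitting every [P] in [PP] with
    [t_e := Pr[e \in T] <= rho_e + mu_e].  Conditionally on [T], let [S] contain
    each [e] independently, with probability [a_e] if [e] is in [T] and [b_e]
    otherwise, where [a] and [b] are chosen so that [Pr[e \in S] = rho_e] and
    [Pr[e \in T \ S] <= mu_e].  If [S] misses [P], then [T \ S] meets [P], which
    by the union bound has probability at most [\sum_(e in P) mu_e].

    (2) => (1): only [mu = 0] is needed.  For [y] in the polyhedron, [min(y, 1)]
    is again in it, and a feasible decomposition of [min(y, 1)] for the
    requirements [1] is a convex combination of vectors [1_S] with [S] hitting
    every [P].  The nonnegative remainder [y - min(y, 1)] is a convex combination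
    of vectors [N * 1_U] for a large integer [N], by independent rounding. *)
Require Import Defs.
From mathcomp Require Import all_boot all_order all_algebra.
From mathcomp Require Import classical_sets reals.
From mathcomp Require Import ring lra.
Set Implicit Arguments.
Unset Strict Implicit.
Unset Printing Implicit Defensive.

Import Order.TTheory GRing.Theory Num.Theory.
Local Open Scope ring_scope.

Section IndependentRounding.
Variables (R : realType) (E : finType) (p : E -> R).

Definition indep_weight (S : {set E}) : R :=
  \prod_e (if e \in S then p e else 1 - p e).

Lemma indep_weight_ge0 S : (forall e, 0 <= p e <= 1) -> 0 <= indep_weight S.
Proof.
move=> p01; apply: prodr_ge0 => e _; have /andP[? ?] := p01 e.
by case: ifP => // _; rewrite subr_ge0.
Qed.

(** Expanding the product of the factors [p e + (1 - p e)] gives one term per set. *)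
Lemma sum_indep_weight : \sum_S indep_weight S = 1.
Proof.
rewrite /indep_weight -bigA_distr big1 // => e _.
by rewrite /= subrKC.
Qed.

Lemma sum_indep_weight_in e0 : \sum_(S : {set E} | e0 \in S) indep_weight S = p e0.
Proof.
(* Setting the factor for [e0 \notin S] to [0] removes the sets avoiding [e0]. *)
pose q e : R := if e == e0 then 0 else 1 - p e.
transitivity (\sum_(S : {set E}) \prod_e (if e \in S then p e else q e)).
  rewrite big_mkcond; apply: eq_bigr => S _; case: ifPn => e0S.
    apply: eq_bigr => e _; case: ifPn => // eS; rewrite /q.
    by case: eqVneq eS => // ->; rewrite e0S.
  by rewrite (bigD1 e0) //= (negPf e0S) /q eqxx mul0r.
rewrite -bigA_distr (bigD1 e0) //= /q eqxx addr0 big1 ?mulr1 // => e /negPf ->.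
by rewrite /= subrKC.
Qed.

Lemma sum_indep_weight_notin e0 :
  \sum_(S : {set E} | e0 \notin S) indep_weight S = 1 - p e0.
Proof.
rewrite -sum_indep_weight -(sum_indep_weight_in e0).
by rewrite [in RHS](bigID (fun S : {set E} => e0 \in S)) /= addrC addrK.
Qed.

End IndependentRounding.

Section Covering.
Variables (R : realType) (E : finType).
Implicit Types (PP : {set {set E}}) (P S T : {set E}) (y rho : {ffun E -> R}).

(** Indices of weight zero are dropped by enumerating the support of [w], so their points may lie
    outside [A]. *)
Lemma convex_hull_finType (I : finType) (A : set {ffun E -> R}) (w : I -> R)
    (v : I -> {ffun E -> R}) y :
  (forall i, 0 <= w i) -> \sum_i w i = 1 -> (forall i, w i != 0 -> A (v i)) ->
  (forall e, y e = \sum_i w i * v i e) -> convex_hull A y.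
Proof.
move=> w0 w1 Av yE; pose B := [pred i | w i != 0].
have sumB (F : I -> R) : (forall i, w i = 0 -> F i = 0) ->
    \sum_i F i = \sum_(k < #|B|) F (enum_val k).
  move=> F0; rewrite -(big_enum_val (A := B) F) [LHS](bigID B) /=.
  rewrite [X in _ + X]big1 ?addr0 // => i.
  by rewrite /B /= negbK => /eqP/F0.
exists #|B|, (fun k => w (enum_val k)), (fun k => v (enum_val k)); split => //.
- by rewrite -sumB.
- by move=> k; apply: Av; have := enum_valP k.
- by move=> e; rewrite yE; apply: sumB => i ->; rewrite mul0r.
Qed.

Lemma convex_hull_covering PP (A : set {ffun E -> R}) :
  (A `<=` covering_polyhedron PP)%classic ->
  (convex_hull A `<=` covering_polyhedron PP)%classic.
Proof.
move=> AY y [n [w [v [w0 w1 Av yE]]]]; split => [e|P PPP].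
  rewrite yE; apply: sumr_ge0 => i _; apply: mulr_ge0 => //.
  by have [] := AY _ (Av i).
under eq_bigr do rewrite yE.
rewrite exchange_big /= -w1; apply: ler_sum => i _.
rewrite -mulr_sumr; apply: ler_peMr => //.
by have [_ ->] := AY _ (Av i).
Qed.

(** Union bound over the elements of [P]. *)
Lemma feasible_star PP (pi : {set E} -> R) rho :
  feasible PP pi rho -> star PP pi rho.
Proof.
move=> [x [x0 _ xrho xpi]] P PPP; apply: le_trans (xpi P PPP) _.
under [leRHS]eq_bigr do rewrite -xrho big_mkcond.
rewrite exchange_big /= [leLHS]big_mkcond; apply: ler_sum => S _.
case: ifPn => [/set0Pn[e] /setIP[eS eP]|_].
  rewrite (bigD1 e) //= eS lerDl; apply: sumr_ge0 => f _.
  by case: ifP.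
by apply: sumr_ge0 => e _; case: ifP.
Qed.

(** A nonzero nonnegative integer is at least 1, so the indicator vector of the support of [v i]
    lies below [v i]. *)
Lemma hitting_sets_of_hull PP y :
  convex_hull (integral_points (covering_polyhedron PP)) y ->
  exists (n : nat) (w : 'I_n -> R) (T : 'I_n -> {set E}),
    [/\ forall i, 0 <= w i, \sum_i w i = 1,
        forall i P, P \in PP -> T i :&: P != finset.set0
      & forall e, \sum_(i | e \in T i) w i <= y e].
Proof.
move=> [n [w [v [w0 w1 vY yE]]]].
exists n, w, (fun i => [set e | v i e != 0]); split => //.
  move=> i P PPP; have [[_ cov] _] := vY i.
  apply/negP => /eqP TP0; have := cov P PPP.
  rewrite big1 ?ler10 // => e eP; apply/eqP; apply/negPn/negP => ve.
  have : e \in [set e | v i e != 0] :&: P by rewrite !inE ve.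
  by rewrite TP0 inE.
move=> e; rewrite yE big_mkcond; apply: ler_sum => i _.
have [[v0 _] vint] := vY i; rewrite inE; case: ifPn => [ve|_]; last exact: mulr_ge0.
apply: ler_peMr => //; rewrite -[v i e]ger0_norm //.
exact: norm_intr_ge1.
Qed.

(* Couples an event of probability [t] with one of probability [r]: [a] and [b]
   are the conditional probabilities of the latter given the former and given
   its complement. *)
Lemma coupling_probabilities (t r m : R) :
  0 <= t <= 1 -> 0 <= r <= 1 -> 0 <= m -> t <= r + m ->
  exists a b, [/\ 0 <= a <= 1, 0 <= b <= 1, t * a + (1 - t) * b = r
                & t * (1 - a) <= m].
Proof.
move=> /andP[t0 t1] /andP[r0 r1] m0 trm; have [tr|rt] := leP t r.
  have [tE|tn1] := eqVneq t 1.
    by exists 1, 0; split; rewrite ?lexx ?ler01 //; lra.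
  have t1' : 0 < 1 - t by rewrite subr_gt0 lt_neqAle tn1.
  exists 1, ((r - t) / (1 - t)); split; rewrite ?lexx ?ler01 //.
  - by rewrite ler_pdivrMr // divr_ge0 ?subr_ge0 //=; lra.
  - by rewrite [_ * (_ / _)]mulrC mulfVK ?gt_eqF //; lra.
  - by lra.
have t0' : 0 < t by exact: le_lt_trans rt.
exists (r / t), 0; split; rewrite ?lexx ?ler01 //.
- by rewrite divr_ge0 //= ler_pdivrMr // mul1r ltW.
- by rewrite mulrC mulfVK ?gt_eqF // mulr0 addr0.
- by rewrite mulrBr mulr1 [t * _]mulrC mulfVK ?gt_eqF //; lra.
Qed.

Lemma hull_feasible PP (mu rho : {ffun E -> R}) :
  in_unit_cube mu -> in_unit_cube rho ->
  convex_hull (integral_points (covering_polyhedron PP)) [ffun e => rho e + mu e] ->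
  feasible PP (fun P => 1 - \sum_(e in P) mu e) rho.
Proof.
move=> mu01 rho01 /hitting_sets_of_hull[n [w [T [w0 w1 hit tle]]]].
pose t e : R := \sum_(i | e \in T i) w i.
have tC e : \sum_(i | e \notin T i) w i = 1 - t e.
  by rewrite -w1 [in RHS](bigID (fun i => e \in T i)) /= addrC addrK.
have coup e : exists ab : R * R,
    [/\ 0 <= ab.1 <= 1, 0 <= ab.2 <= 1, t e * ab.1 + (1 - t e) * ab.2 = rho e
      & t e * (1 - ab.1) <= mu e].
  have /andP[mu0 _] := mu01 e; have := tle e; rewrite ffunE => tle_e.
  have t01 : 0 <= t e <= 1 by rewrite -[t e <= 1]subr_ge0 -tC !sumr_ge0.
  by have [a [b abP]] := coupling_probabilities t01 (rho01 e) mu0 tle_e; exists (a, b).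
have [ab abP] := boolp.choice coup.
pose p i e := if e \in T i then (ab e).1 else (ab e).2.
have p01 i e : 0 <= p i e <= 1 by rewrite /p; case: ifP; have [] := abP e.
exists [ffun S => \sum_i w i * indep_weight (p i) S]; split.
- move=> S; rewrite ffunE; apply: sumr_ge0 => i _; apply: mulr_ge0 => //.
  exact: indep_weight_ge0.
- under eq_bigr do rewrite ffunE.
  rewrite exchange_big -[RHS]w1; apply: eq_bigr => i _.
  by rewrite -mulr_sumr sum_indep_weight mulr1.
- move=> e; under eq_bigr do rewrite ffunE.
  rewrite exchange_big /=.
  under eq_bigr do rewrite -mulr_sumr sum_indep_weight_in.
  have [_ _ <- _] := abP e; rewrite -tC /t (bigID (fun i => e \in T i)) /=.
  rewrite !mulr_suml; congr (_ + _); apply: eq_bigr => i; rewrite /p.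
    by move=> ->.
  by move/negPf => ->.
move=> P PPP; under [leRHS] eq_bigr do rewrite ffunE.
rewrite exchange_big /=; under [leRHS] eq_bigr do rewrite -mulr_sumr.
rewrite lerBlDr -{1}w1 -lerBlDl -sumrB.
(* The left side is now the probability that [S] misses [P]; the middle term is the expected size of
   [(T \ S) :&: P]. *)
apply: (@le_trans _ _ (\sum_i \sum_(e in P | e \in T i) w i * (1 - (ab e).1))).
  apply: ler_sum => i _.
  have /set0Pn[e0 /setIP[e0T e0P]] := hit i P PPP.
  rewrite -{1}[w i]mulr1 -mulrBr -mulr_sumr; apply: ler_wpM2l => //.
  rewrite -{1}(sum_indep_weight (p i)).
  rewrite (bigID (fun S => S :&: P != finset.set0)) /= addrAC subrr add0r.
  (* A set missing [P] avoids [e0] in particular, and [e0] accounts for one term of the nonnegative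
     sum. *)
  apply: (@le_trans _ _ (1 - p i e0)).
    rewrite -sum_indep_weight_notin big_mkcond [leRHS]big_mkcond.
    apply: ler_sum => S _; rewrite negbK; case: ifPn => [/eqP SP|_].
      case: ifPn => // /negPn e0S; have : e0 \in S :&: P by rewrite inE e0S.
      by rewrite SP inE.
    by case: ifP => // _; apply: indep_weight_ge0.
  rewrite /p e0T (bigD1 e0) /= ?e0P ?e0T // lerDl; apply: sumr_ge0 => e _.
  by rewrite subr_ge0; have [/andP[]] := abP e.
rewrite (exchange_big_dep (fun e => e \in P)) /=; last by move=> i e _ /andP[].
apply: ler_sum => e eP; have [_ _ _] := abP e; apply: le_trans.
by rewrite /t mulr_suml (eq_bigl (fun i => e \in T i)) // => i; rewrite eP.
Qed.

(** Either some element of [P] is truncated to 1 and covers [P] alone, or truncation changes nothing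
    on [P]. *)
Lemma covering_min1 PP y : covering_polyhedron PP y ->
  covering_polyhedron PP [ffun e => Num.min (y e) 1].
Proof.
move=> [y0 ycov]; have m0 e : 0 <= Num.min (y e) 1 by rewrite le_min y0 ler01.
split => [e|P PPP]; first by rewrite ffunE.
under eq_bigr do rewrite ffunE.
have [/existsP[e /andP[eP ye]]|/existsPn y1] := boolP [exists e, (e \in P) && (1 <= y e)].
  by rewrite (bigD1 e) //= (min_idPr ye) lerDl sumr_ge0.
rewrite (eq_bigr y) ?ycov // => e eP; apply/min_idPl/ltW.
by have := y1 e; rewrite eP /= -ltNge.
Qed.

Lemma covering_hull PP y :
  star_sufficient PP (fun _ => 1 : R) -> covering_polyhedron PP y ->
  convex_hull (integral_points (covering_polyhedron PP)) y.
Proof.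
move=> suff yY; have [y0 _] := yY.
pose y1 := [ffun e => Num.min (y e) 1]; have [y10 y1cov] := covering_min1 yY.
have y1cube : in_unit_cube y1.
  by move=> e; rewrite y10 ffunE ge_min lexx orbT.
have [x [x0 x1 xy xhit]] := (suff y1 y1cube).2 y1cov.
pose z e := y e - y1 e.
have z0 e : 0 <= z e by rewrite subr_ge0 ffunE ge_min lexx.
(* One integer bounding every [z e]; the successor keeps it positive when [E] is empty. *)
pose N := (\sum_e Num.bound (z e)).+1.
have N0 : 0 < N%:R :> R by rewrite ltr0n.
have zN e : z e <= N%:R.
  apply: le_trans (ltW (archi_boundP (z0 e))) _.
  by rewrite ler_nat /N (bigD1 e) //= -addSn leqW ?leq_addr // addSn ltnS leq_addr.
pose q e := z e / N%:R.
have q01 e : 0 <= q e <= 1 by rewrite divr_ge0 //= ler_pdivrMr // mul1r.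
(* [S] and [U] are drawn independently: [S] averages to [y1], and [N] times the indicator of [U]
   averages to [z]. *)
pose w (SU : {set E} * {set E}) := x SU.1 * indep_weight q SU.2.
pose v (SU : {set E} * {set E}) : {ffun E -> R} :=
  [ffun e => (e \in SU.1)%:R + N%:R * (e \in SU.2)%:R].
have sum_ind (f : {set E} -> R) e : \sum_S f S * (e \in S)%:R = \sum_(S : {set E} | e \in S) f S.
  rewrite [RHS]big_mkcond; apply: eq_bigr => S _.
  by case: ifP; rewrite ?mulr1 ?mulr0.
apply: (convex_hull_finType (w := w) (v := v)).
- by move=> SU; apply: mulr_ge0 => //; apply: indep_weight_ge0.
- rewrite -(pair_bigA _ (fun S U => x S * indep_weight q U)) /=.
  by under eq_bigr do rewrite -mulr_sumr sum_indep_weight mulr1.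
- move=> [S U]; rewrite /w mulf_eq0 negb_or /= => /andP[xS _].
  split; last by move=> e; rewrite ffunE rpredD ?rpredM ?natr_int.
  split => [e|P PPP]; first by rewrite ffunE addr_ge0 ?mulr_ge0 ?ler0n.
  have /set0Pn[e /setIP[eS eP]] : S :&: P != finset.set0.
    (* If [S], of positive weight, missed [P], the sets meeting [P] would have total weight below
       1. *)
    apply/negP => SP; have := xhit P PPP; apply/negP; rewrite -ltNge -x1.
    rewrite [ltRHS](bigID (fun S => S :&: P != finset.set0)) /= ltrDl.
    rewrite (bigD1 S) /= ?negbK // ltr_wpDr ?sumr_ge0 //.
    by rewrite lt_neqAle eq_sym xS x0.
  rewrite (bigD1 e) //= ffunE eS -addrA lerDl addr_ge0 ?mulr_ge0 ?ler0n //.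
  by apply: sumr_ge0 => f _; rewrite ffunE addr_ge0 ?mulr_ge0 ?ler0n.
move=> e; rewrite -(pair_bigA _ (fun S U => w (S, U) * v (S, U) e)) /=.
transitivity (\sum_S (x S * (e \in S)%:R + x S * z e)); last first.
  apply: eq_bigr => S _.
  transitivity (\sum_U (x S * (e \in S)%:R * indep_weight q U
                 + x S * N%:R * (indep_weight q U * (e \in U)%:R))); last first.
    by apply: eq_bigr => U _; rewrite /w /v ffunE /=; ring.
  rewrite big_split /= -!mulr_sumr sum_indep_weight mulr1 sum_ind.
  by rewrite sum_indep_weight_in /q -mulrA [N%:R * _]mulrC mulfVK ?gt_eqF.
rewrite big_split /= sum_ind xy -mulr_suml x1 mul1r /z.
by rewrite addrC subrK.
Qed.

End Covering.

Theorem theorem1 (R : realType) (E : finType) (PP : {set {set E}}) :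
  weak_mfmc R PP <->
  (forall mu : {ffun E -> R}, in_unit_cube mu ->
     star_sufficient PP (fun P : {set E} => 1 - \sum_(e in P) mu e)).
Proof.
split => [mfmc mu mu01 rho rho01|suff].
  split; first exact: feasible_star.
  (* Integrality reduces the hull membership to the covering inequalities for [rho + mu], which
     restate [star]. *)
  move=> rhostar; apply: hull_feasible => //; rewrite -mfmc; split => [e|P PPP].
    by rewrite ffunE addr_ge0 //; [case/andP: (rho01 e)|case/andP: (mu01 e)].
  under eq_bigr do rewrite ffunE.
  by rewrite big_split /= -lerBlDr; apply: rhostar.
apply/seteqP; split; last by apply: convex_hull_covering => y [].
move=> y; apply: covering_hull.
have mu01 : in_unit_cube ([ffun=> 0] : {ffun E -> R}).
  by move=> e; rewrite ffunE lexx ler01.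
have <- : (fun P : {set E} => 1 - \sum_(e in P) [ffun=> 0 : R] e) = (fun=> 1).
  by apply: boolp.funext => P; rewrite big1 ?subr0 // => e _; rewrite ffunE.
exact: suff.
Qed.
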